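(* For every integer $N\geq 2$, the doily generation algorithm described in the context is correct and complete: each labeling $f$ that it retains (does not discard) is a labeling of an $N$-qubit doily, and every $N$-qubit doily is produced by exactly one retained labeling.
   Context: An $N$-qubit observable (point of $W_N$) is a word of length $N$ over $\{I,X,Y,Z\}$ other than $I\cdots I$, encoding the tensor product of the corresponding identity/Pauli matrices, where $X=\begin{pmatrix}0&1\\1&0\end{pmatrix}$, $Y=\begin{pmatrix}0&-i\\i&0\end{pmatrix}$, $Z=\begin{pmatrix}1&0\\0&-1\end{pmatrix}$. The matrix product of two observables is, up to a scalar in $\{\pm1,\pm i\}$, an observable or the identity $\mathcal{I}_N$; two observables commute or anticommute. For commuting distinct $a,b$, $|a.b|$ denotes the observable equal to the matrix product $a.b$ up to sign. An $N$-qubit doily is a set of 15 distinct $N$-qubit observables that carries the structure of the generalized quadrangle $\mathrm{GQ}(2,2)$ (15 points, 15 lines, 3 points per line, 3 lines per point, and for a point $p$ not on a line $L$ a unique point of $L$ collinear with $p$), such that two distinct observables of the set commute if and only if they lie on a common line, and on each line the product of two of the observables is, up to sign, the third. $W_2$ (the set of all 15 two-qubit observables) is a doily. A labeling of an $N$-qubit doily is an injective map $f$ from the points of $W_2$ to points of $W_N$, with image that doily, preserving commutation and anticommutation, with $f(|a.b|)=|f(a).f(b)|$ for distinct commuting $a,b$. An $N$-qubit ovoid is a set of 5 mutually anticommuting $N$-qubit observables whose product is $\pm\mathcal{I}_N$. Each $N$-qubit doily contains exactly six ovoids. Observables are ordered lexicographically with $I<X<Z<Y$; sets of observables are ordered lexicographically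 after listing their elements in increasing order. Algorithm. For each ovoid $O=\{o_1<o_2<o_3<o_4<o_5\}$ in $W_N$: set $f(IX)=o_1$, $f(IZ)=o_2$, $f(XY)=o_3$, $f(ZY)=o_4$, $f(YY)=o_5$. For each observable $c$ of $W_N$ commuting with $o_1,o_2,o_3$ and anticommuting with $o_4,o_5$: set $f(XI)=c$; then for each triple $(p,q,r)$ in the sequence $(XI,IX,XX)$, $(XI,IZ,XZ)$, $(XI,XY,IY)$, $(ZY,XX,YZ)$, $(ZY,XZ,YX)$, $(ZY,IY,ZI)$, $(YY,XX,ZZ)$, $(YY,XZ,ZX)$, $(YY,IY,YI)$, in this order, set $f(r)=|f(p).f(q)|$. If $O$ is not the smallest of the ovoids contained in the image of $f$, discard $f$; otherwise retain $f$. *)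

(* Defs.v *)
(* Mathematical Components, with the Kronecker product [*t] of real_closed. *)
From HB Require Import structures.
From mathcomp Require Import all_boot all_order all_algebra all_field.
From mathcomp Require Import mxtens.
Set Implicit Arguments.
Unset Strict Implicit.
Unset Printing Implicit Defensive.
Import Order.TTheory GRing.Theory Num.Theory.
Local Open Scope ring_scope.

(** * Observables *)

Inductive pauli : predArgType := pI | pX | pZ | pY.

(* The numbering fixes the order I < X < Z < Y. *)
Definition pauli_rank (p : pauli) : 'I_4 :=
  match p with
  | pI => @Ordinal 4 0 isT
  | pX => @Ordinal 4 1 isT
  | pZ => @Ordinal 4 2 isT
  | pY => @Ordinal 4 3 isT
  end.
Definition pauli_of_rank (i : 'I_4) : pauli := nth pI [:: pI; pX; pZ; pY] i.

Lemma pauli_rankK : cancel pauli_rank pauli_of_rank.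
Proof. by case. Qed.

HB.instance Definition _ := Finite.copy pauli (can_type pauli_rankK).

Fact pauli_display : Order.disp_t. Proof. exact: Order.Disp tt tt. Qed.
HB.instance Definition _ : Order.isPOrder pauli_display pauli :=
  Order.CanIsPartial pauli_display pauli_rankK.
HB.instance Definition _ :=
  Order.MonoTotal.Build pauli_display pauli (fun _ _ => erefl).

Definition id_word (N : nat) : N.-tuple pauli := [tuple of nseq N pI].

Record obs (N : nat) : predArgType := Obs {
  word_of : N.-tuple pauli;
  _ : word_of != id_word N
}.

HB.instance Definition _ (N : nat) := [isSub for @word_of N].
HB.instance Definition _ (N : nat) := [Finite of obs N by <:].

Definition mx2 (a b c d : algC) : 'M[algC]_2 :=
  \matrix_(i, j) nth 0 (nth [::] [:: [:: a; b]; [:: c; d]] i) j.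

Definition pauli_mx (p : pauli) : 'M[algC]_2 :=
  match p with
  | pI => 1%:M
  | pX => mx2 0 1 1 0
  | pY => mx2 0 (- 'i) 'i 0
  | pZ => mx2 1 0 0 (- 1)
  end.

Fixpoint word_mx (N : nat) : N.-tuple pauli -> 'M[algC]_(2 ^ N) :=
  match N with
  | 0 => fun=> 1%:M
  | n.+1 => fun w =>
      castmx (esym (expnS 2 n), esym (expnS 2 n))
             (pauli_mx (thead w) *t word_mx [tuple of behead w])
  end.

Definition obs_mx (N : nat) (a : obs N) : 'M[algC]_(2 ^ N) := word_mx (word_of a).

Definition commuting (N : nat) (a b : obs N) : bool :=
  obs_mx a *m obs_mx b == obs_mx b *m obs_mx a.

Definition anticommuting (N : nat) (a b : obs N) : bool :=
  obs_mx a *m obs_mx b == - (obs_mx b *m obs_mx a).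

(* The observable |a.b|; it is [None] when a.b is not, up to sign, the matrix
   of an observable, that is, when a = b or when a and b anticommute. *)
Definition absprod (N : nat) (a b : obs N) : option (obs N) :=
  [pick c | (obs_mx a *m obs_mx b == obs_mx c)
         || (obs_mx a *m obs_mx b == - obs_mx c)].

(** * Orders on observables and on sets of observables *)

(* The order on words is lexicographic, and so is that on lists of words. *)
Definition obs_le (N : nat) : rel (obs N) := fun a b =>
  ((word_of a : N.-tuplelexi pauli) <= word_of b)%O.

Definition listing (N : nat) (A : {set obs N}) : seq (obs N) :=
  sort (@obs_le N) (enum A).

Definition set_le (N : nat) : rel {set obs N} := fun A B =>
  ((map (@word_of N) (listing A) : seqlexi (N.-tuplelexi pauli))
     <= map (@word_of N) (listing B))%O.

(** * Doilies, labelings and ovoids *)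

(* GQ(2,2), with a line identified with its set of points. *)
Definition collinear (T : finType) (L : {set {set T}}) (p q : T) : bool :=
  [exists l in L, (p \in l) && (q \in l)].

Definition is_GQ22 (T : finType) (P : {set T}) (L : {set {set T}}) : Prop :=
  [/\ #|P| = 15%N,
      #|L| = 15%N,
      forall l, l \in L -> l \subset P /\ #|l| = 3%N,
      forall p, p \in P -> #|[set l in L | p \in l]| = 3%N
    & forall p l, p \in P -> l \in L -> p \notin l ->
        exists! q, q \in l /\ collinear L p q].

Definition is_doily (N : nat) (D : {set obs N}) : Prop :=
  exists L : {set {set obs N}},
    [/\ is_GQ22 D L,
        forall a b, a \in D -> b \in D -> a != b ->
          commuting a b = collinear L a b
      & forall l, l \in L -> forall a b c, a \in l -> b \in l -> c \in l ->
          uniq [:: a; b; c] -> absprod a b = Some c].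

Definition is_labeling (N : nat) (D : {set obs N}) (f : obs 2 -> obs N) : Prop :=
  [/\ injective f,
      f @: [set: obs 2] = D,
      forall a b, commuting a b -> commuting (f a) (f b),
      forall a b, anticommuting a b -> anticommuting (f a) (f b)
    & forall a b, a != b -> commuting a b ->
        exists2 c, absprod a b = Some c & absprod (f a) (f b) = Some (f c)].

(* For mutually anticommuting factors, reordering the product changes at most
   its sign. *)
Definition is_ovoid (N : nat) (Ov : {set obs N}) : bool :=
  let M := \big[mulmx/1%:M]_(o <- listing Ov) obs_mx o in
  [&& #|Ov| == 5%N,
      [forall a in Ov, forall b in Ov, (a != b) ==> anticommuting a b]
    & (M == 1%:M) || (M == - 1%:M)].

(** * The algorithm *)

Local Notation "'` p q" := (@Obs 2 [tuple p; q] isT)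
  (at level 10, p at level 8, q at level 8).

Definition IX := '` pI pX.  Definition IZ := '` pI pZ.
Definition IY := '` pI pY.  Definition XI := '` pX pI.
Definition XX := '` pX pX.  Definition XZ := '` pX pZ.
Definition XY := '` pX pY.  Definition ZI := '` pZ pI.
Definition ZX := '` pZ pX.  Definition ZZ := '` pZ pZ.
Definition ZY := '` pZ pY.  Definition YI := '` pY pI.
Definition YX := '` pY pX.  Definition YZ := '` pY pZ.
Definition YY := '` pY pY.

(* The variable f of the algorithm: [None] at the points not yet assigned, or
   assigned an undefined product. *)
Definition partial_map (N : nat) := {ffun obs 2 -> option (obs N)}.

Definition assign (N : nat) (f : partial_map N) (r : obs 2) (v : option (obs N)) :
    partial_map N :=
  [ffun x => if x == r then v else f x].

Definition step (N : nat) (f : partial_map N) (t : obs 2 * obs 2 * obs 2) :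
    partial_map N :=
  let '(p, q, r) := t in
  assign f r (if (f p, f q) is (Some a, Some b) then absprod a b else None).

Definition triples : seq (obs 2 * obs 2 * obs 2) :=
  [:: (XI, IX, XX); (XI, IZ, XZ); (XI, XY, IY);
      (ZY, XX, YZ); (ZY, XZ, YX); (ZY, IY, ZI);
      (YY, XX, ZZ); (YY, XZ, ZX); (YY, IY, YI)].

Definition generate (N : nat) (o1 o2 o3 o4 o5 c : obs N) : partial_map N :=
  let f : partial_map N := [ffun=> None] in
  let f := assign f IX (Some o1) in
  let f := assign f IZ (Some o2) in
  let f := assign f XY (Some o3) in
  let f := assign f ZY (Some o4) in
  let f := assign f YY (Some o5) in
  let f := assign f XI (Some c) in
  foldl (@step N) f triples.

Definition pimage (N : nat) (f : partial_map N) : {set obs N} :=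
  [set a | [exists x, f x == Some a]].

Definition smallest_ovoid (N : nat) (Ov D : {set obs N}) : bool :=
  [&& is_ovoid Ov, Ov \subset D
    & [forall Ov' : {set obs N},
         is_ovoid Ov' && (Ov' \subset D) ==> set_le Ov Ov']].

Definition retained_from (N : nat) (Ov : {set obs N}) : seq (partial_map N) :=
  if listing Ov is [:: o1; o2; o3; o4; o5] then
    [seq f <- [seq generate o1 o2 o3 o4 o5 c
              | c <- enum {: obs N}
              & [&& commuting c o1, commuting c o2, commuting c o3,
                    anticommuting c o4 & anticommuting c o5]]
    | smallest_ovoid Ov (pimage f)]
  else [::].

(* The labelings retained in a run of the algorithm, with multiplicity. *)
Definition doily_generation (N : nat) : seq (partial_map N) :=
  flatten [seq retained_from Ov
          | Ov <- enum [set Ov : {set obs N} | is_ovoid Ov]].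

(* Main.v *)
Require Import Defs.
From HB Require Import structures.
From mathcomp Require Import all_boot all_order all_algebra all_field.
From mathcomp Require Import mxtens.
Set Implicit Arguments.
Unset Strict Implicit.
Unset Printing Implicit Defensive.
Import Order.TTheory GRing.Theory Num.Theory.
Local Open Scope ring_scope.

(* Up to phases, Pauli words form an F_2-vector space, with addition [wadd], on
   which (anti)commutation is the value of a symplectic form [sp]. An ovoid is
   then a family of five words of sum 0, pairwise of form 1, and the values of
   the algorithm on the points of W_2 are fixed combinations of o1, ..., o4, c;
   a finite computation in W_2 shows that they preserve [sp] and the lines,
   whence a labeling of a doily.

   Conversely, a doily D is closed under sums of commuting points. It contains
   an ovoid, built from two noncollinear points and their three common
   neighbours. For any ovoid O of D, adding points of O to a point collinear
   with exactly three points of O leads to a point c of D commuting with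
   o1, o2, o3 and not with o4, o5. The algorithm run on (O, c) stays in D and
   gives 15 distinct points, so its image is D; in turn this labeling of D
   shows that c is unique. Hence D is produced exactly once by each of its
   ovoids, and only its smallest one is retained. *)

(** * Words as symplectic vectors *)

(** The Klein four-group: product of Pauli matrices up to phase. *)
Definition padd (p q : pauli) : pauli :=
  match p, q with
  | pI, r | r, pI => r
  | pX, pZ | pZ, pX => pY
  | pX, pY | pY, pX => pZ
  | pZ, pY | pY, pZ => pX
  | _, _ => pI
  end.

(** Anticommutation of two Pauli matrices, that is, the symplectic form on F_2^2. *)
Definition pskew (p q : pauli) : bool := [&& p != pI, q != pI & p != q].

Definition pphase (p q : pauli) : algC :=
  match p, q with
  | pX, pY | pY, pZ | pZ, pX => 'i
  | pY, pX | pZ, pY | pX, pZ => - 'i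
  | _, _ => 1
  end.

Lemma pauli_mxM p q :
  pauli_mx p *m pauli_mx q = pphase p q *: pauli_mx (padd p q).
Proof.
apply/matrixP=> i j; rewrite mxE !big_ord_recl big_ord0 !mxE addr0.
by case: p; case: q; case: i j => [[|[|?]] ?] // [[|[|?]] ?] //;
  rewrite /pphase /padd ?mxE /= ?mxE ?(mul1r, mulr1, mul0r, mulr0, addr0, add0r,
    mulNr, mulrN, mulN1r, mulrN1, opprK, oppr0, mulCii).
Qed.

Lemma pphaseC p q : pphase p q = (-1) ^+ pskew p q * pphase q p.
Proof. by case: p; case: q; rewrite /= ?expr0 ?expr1 ?mul1r ?mulN1r ?opprK. Qed.

Lemma pphase_sqr p q : pphase p q ^+ 2 = (-1) ^+ pskew p q.
Proof. by case: p; case: q; rewrite /= ?sqrrN ?sqrCi ?expr1n. Qed.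

Definition wadd N (u v : N.-tuple pauli) : N.-tuple pauli :=
  [tuple padd (tnth u i) (tnth v i) | i < N].

Definition sp N (u v : N.-tuple pauli) : bool :=
  \big[addb/false]_(i < N) pskew (tnth u i) (tnth v i).

Definition phase N (u v : N.-tuple pauli) : algC :=
  \prod_(i < N) pphase (tnth u i) (tnth v i).

Lemma tnth_id N i : tnth (id_word N) i = pI.
Proof. by rewrite (tnth_nth pI) nth_nseq ltn_ord. Qed.

Lemma waddC N : commutative (@wadd N).
Proof.
move=> u v; apply: eq_from_tnth => i; rewrite !tnth_mktuple.
by case: (tnth u i); case: (tnth v i).
Qed.

Lemma waddA N : associative (@wadd N).
Proof.
move=> u v w; apply: eq_from_tnth => i; rewrite !tnth_mktuple.
by case: (tnth u i); case: (tnth v i); case: (tnth w i).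
Qed.

Lemma wadd0w N : left_id (id_word N) (@wadd N).
Proof. by move=> u; apply: eq_from_tnth => i; rewrite tnth_mktuple tnth_id. Qed.

HB.instance Definition _ N :=
  Monoid.isComLaw.Build (N.-tuple pauli) (id_word N) (@wadd N)
    (@waddA N) (@waddC N) (@wadd0w N).

Lemma waddw0 N : right_id (id_word N) (@wadd N).
Proof. by move=> u; rewrite waddC wadd0w. Qed.

Lemma waddww N (u : N.-tuple pauli) : wadd u u = id_word N.
Proof.
apply: eq_from_tnth => i; rewrite tnth_mktuple tnth_id.
by case: (tnth u i).
Qed.

Lemma waddKw N (u : N.-tuple pauli) : involutive (wadd u).
Proof. by move=> v; rewrite waddA waddww wadd0w. Qed.

Lemma wadd_eq0 N (u v : N.-tuple pauli) : wadd u v = id_word N -> u = v.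
Proof. by move=> uv0; rewrite -[v](waddKw u) uv0 waddw0. Qed.

Lemma spC N (u v : N.-tuple pauli) : sp u v = sp v u.
Proof. by apply: eq_bigr => i _; case: (tnth u i); case: (tnth v i). Qed.

Lemma spww N (u : N.-tuple pauli) : sp u u = false.
Proof. by apply: big1 => i _; case: (tnth u i). Qed.

Lemma sp0w N (u : N.-tuple pauli) : sp (id_word N) u = false.
Proof. by apply: big1 => i _; rewrite tnth_id. Qed.

Lemma spDl N (u v w : N.-tuple pauli) : sp (wadd u v) w = sp u w (+) sp v w.
Proof.
rewrite -big_split; apply: eq_bigr => i _; rewrite tnth_mktuple.
by case: (tnth u i); case: (tnth v i); case: (tnth w i).
Qed.

Lemma spDr N (u v w : N.-tuple pauli) : sp u (wadd v w) = sp u v (+) sp u w.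
Proof. by rewrite spC spDl !(spC u). Qed.

(** * Matrices of words: products, traces, independence *)

Lemma mulmx_castsq (R : pzRingType) m n (e : m = n) (A B : 'M[R]_m) :
  castmx (e, e) A *m castmx (e, e) B = castmx (e, e) (A *m B).
Proof. by case: n / e; rewrite !castmx_id. Qed.

Lemma word_mxM N (u v : N.-tuple pauli) :
  word_mx u *m word_mx v = phase u v *: word_mx (wadd u v).
Proof.
elim: N u v => [|N IH] u v /=; first by rewrite /phase big_ord0 scale1r mul1mx.
rewrite mulmx_castsq tensmx_mul pauli_mxM IH.
have -> : thead (wadd u v) = padd (thead u) (thead v).
  by rewrite /thead tnth_mktuple.
have -> : [tuple of behead (wadd u v)]
          = wadd [tuple of behead u] [tuple of behead v].
  apply: eq_from_tnth => i.
  by rewrite [RHS]tnth_mktuple !tnth_behead [LHS]tnth_mktuple.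
have -> : phase u v = pphase (thead u) (thead v)
            * phase [tuple of behead u] [tuple of behead v].
  rewrite /phase big_ord_recl; congr (_ * _).
  apply: eq_bigr => i _; rewrite !tnth_behead.
  suff -> : lift ord0 i = inord i.+1 by [].
  by apply/val_inj; rewrite /= inordK ?ltnS.
apply/matrixP=> i j; rewrite castmxE !mxE castmxE !mxE.
by rewrite !mulrA; congr (_ * _); rewrite -!mulrA; congr (_ * _); rewrite mulrC.
Qed.

Lemma word_mx_id N : word_mx (id_word N) = 1%:M.
Proof.
elim: N => [|N IH] //=.
have -> : [tuple of behead (id_word N.+1)] = id_word N by apply: val_inj.
rewrite IH; apply/matrixP=> i j; rewrite castmxE [RHS]mxE.
set i' := cast_ord _ i; set j' := cast_ord _ j.
have -> : (i == j) = (i' == j') by rewrite -!val_eqE.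
case: (mxtens_indexP i') (mxtens_indexP j') => [i0 i1] [j0 j1].
rewrite tensmxE !mxE -natrM mulnb (can_eq (@mxtens_indexK _ _)) xpair_eqE //.
Qed.

Lemma mxtrace_tens (R : pzRingType) m n (A : 'M[R]_m) (B : 'M[R]_n) :
  \tr (A *t B) = \tr A * \tr B.
Proof.
rewrite /mxtrace mulr_sum; apply: eq_bigr => i _.
by case: (mxtens_indexP i) => i0 i1; rewrite tensmxE mxtens_indexK.
Qed.

Lemma mxtrace_cast (R : pzRingType) m n (e : m = n) (A : 'M[R]_m) :
  \tr (castmx (e, e) A) = \tr A.
Proof. by case: n / e; rewrite castmx_id. Qed.

(** The trace is multiplicative on Kronecker products, and some factor is X, Y or Z, of trace 0. *)
Lemma mxtrace_word_mx N (w : N.-tuple pauli) :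
  w != id_word N -> \tr (word_mx w) = 0.
Proof.
elim: N w => [|N IH] w /=; first by rewrite tuple0 [id_word _]tuple0 eqxx.
rewrite mxtrace_cast mxtrace_tens.
case/tupleP: w => p w; rewrite theadE.
have -> : [tuple of behead [tuple of p :: w]] = w by apply: val_inj.
case: (w =P id_word N) => [->|/eqP w0 _]; last by rewrite IH ?mulr0.
case: p => /= [/eqP[]|_|_|_]; first exact: val_inj.
all: by rewrite /mxtrace !big_ord_recl big_ord0 !mxE /= ?(addr0, addrN) mul0r.
Qed.

(** Only anticommuting positions contribute ['i] or [- 'i], of square -1. *)
Lemma phase_sqr N (u v : N.-tuple pauli) : phase u v ^+ 2 = (-1) ^+ sp u v.
Proof.
rewrite /phase /sp -prodrXl.
elim/big_rec2: _ => [|i b x _ ->]; first by rewrite expr0.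
by rewrite pphase_sqr signr_addb.
Qed.

Lemma phaseC N (u v : N.-tuple pauli) : phase u v = (-1) ^+ sp u v * phase v u.
Proof.
rewrite /phase /sp.
elim/big_rec3: _ => [|i b x y _ ->]; first by rewrite expr0 mulr1.
by rewrite pphaseC signr_addb mulrACA.
Qed.

Lemma phase_neq0 N (u v : N.-tuple pauli) : phase u v != 0.
Proof. by rewrite -sqrf_eq0 phase_sqr signr_eq0. Qed.

Lemma scalar1_neq0 N : (1%:M : 'M[algC]_(2 ^ N)) != 0.
Proof.
apply/eqP=> /(congr1 mxtrace)/eqP.
by rewrite mxtrace1 mxtrace0 pnatr_eq0 expn_eq0.
Qed.

Lemma word_mx_sqr N (u : N.-tuple pauli) : word_mx u *m word_mx u = 1%:M.
Proof.
rewrite word_mxM waddww word_mx_id; suff -> : phase u u = 1 by rewrite scale1r.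
by rewrite /phase big1 // => i _; case: (tnth u i).
Qed.

Lemma word_mx_neq0 N (u : N.-tuple pauli) : word_mx u != 0.
Proof.
apply/eqP=> u0; have /eqP := word_mx_sqr u.
by rewrite u0 mul0mx eq_sym (negPf (scalar1_neq0 N)).
Qed.

(** For u and v distinct, the identity u.u would be a multiple of the traceless matrix of
    [wadd u v]. *)
Lemma word_mx_scale_inj N (a : algC) (u v : N.-tuple pauli) :
  word_mx u = a *: word_mx v -> u = v.
Proof.
move=> uv; apply: wadd_eq0; apply/eqP/contraT => /mxtrace_word_mx tr0.
have /(congr1 mxtrace)/eqP := word_mx_sqr u.
rewrite {2}uv -scalemxAr word_mxM !mxtraceZ tr0 !mulr0 mxtrace1.
by rewrite eq_sym pnatr_eq0 expn_eq0.
Qed.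

Lemma scale_word_mx_inj N (u : N.-tuple pauli) : injective ( *:%R^~ (word_mx u)).
Proof.
move=> a b /eqP; rewrite -subr_eq0 -scalerBl scaler_eq0 subr_eq0.
by rewrite (negPf (word_mx_neq0 u)) orbF => /eqP.
Qed.

(** * Commutation and |a.b| in terms of words *)

Lemma commutingE N (a b : obs N) :
  commuting a b = ~~ sp (word_of a) (word_of b).
Proof.
rewrite /commuting /obs_mx !word_mxM (waddC (word_of b)) phaseC.
rewrite (inj_eq (@scale_word_mx_inj _ _)).
case: (sp _ _); rewrite ?expr1 ?expr0 ?mul1r ?eqxx // mulN1r.
by rewrite eqNr (negPf (phase_neq0 _ _)).
Qed.

Lemma anticommutingE N (a b : obs N) :
  anticommuting a b = sp (word_of a) (word_of b).
Proof.
rewrite /anticommuting /obs_mx !word_mxM (waddC (word_of b)) phaseC -scaleNr.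
rewrite (inj_eq (@scale_word_mx_inj _ _)).
case: (sp _ _); rewrite ?expr1 ?expr0 ?mul1r ?mulN1r ?eqxx //.
by rewrite eq_sym eqNr (negPf (phase_neq0 _ _)).
Qed.

Lemma sqr_phase1 N (u v : N.-tuple pauli) :
  (phase u v == 1) || (phase u v == -1) = ~~ sp u v.
Proof.
rewrite -sqrf_eq1 phase_sqr; case: (sp u v); rewrite ?expr1 ?expr0 ?eqxx //.
by rewrite eqNr oner_eq0.
Qed.

Lemma absprodP N (a b c : obs N) :
  reflect (~~ sp (word_of a) (word_of b)
             /\ word_of c = wadd (word_of a) (word_of b))
          (absprod a b == Some c).
Proof.
have E d : (obs_mx a *m obs_mx b == obs_mx d)
         || (obs_mx a *m obs_mx b == - obs_mx d)
         = ~~ sp (word_of a) (word_of b)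
           && (word_of d == wadd (word_of a) (word_of b)).
  rewrite /obs_mx !word_mxM.
  have [->|ne] := word_of d =P wadd _ _.
    rewrite andbT -sqr_phase1 -scaleN1r -{2}[word_mx _]scale1r.
    by rewrite !(inj_eq (@scale_word_mx_inj _ _)).
  rewrite andbF; apply/negbTE/negP => /orP[]/eqP e; case: ne.
    exact/(@word_mx_scale_inj _ (phase (word_of a) (word_of b))).
  apply/(@word_mx_scale_inj _ (- phase (word_of a) (word_of b))).
  by rewrite scaleNr e opprK.
(* By [E] at most one candidate passes the test, so the choice made by [pick] is forced. *)
rewrite /absprod; case: pickP => [d|no].
  rewrite E => /andP[-> /eqP dE]; apply: (iffP eqP) => [[<-] //|[_ cE]].
  by congr Some; apply: val_inj; rewrite /= cE.
constructor => -[nab cE]; have := no c.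
by rewrite E nab cE eqxx.
Qed.

Lemma absprod_Some N (a b c : obs N) :
  ~~ sp (word_of a) (word_of b) -> word_of c = wadd (word_of a) (word_of b) ->
  absprod a b = Some c.
Proof. by move=> ab cE; apply/eqP/absprodP. Qed.

(** * Ovoids *)

Lemma perm_listing N (A : {set obs N}) : perm_eq (listing A) (enum A).
Proof. by rewrite perm_sort. Qed.

Lemma mem_listing N (A : {set obs N}) : listing A =i A.
Proof. by move=> a; rewrite (perm_mem (perm_listing A)) mem_enum. Qed.

Lemma listing_uniq N (A : {set obs N}) : uniq (listing A).
Proof. by rewrite (perm_uniq (perm_listing A)) enum_uniq. Qed.

Lemma size_listing N (A : {set obs N}) : size (listing A) = #|A|.
Proof. by rewrite (perm_size (perm_listing A)) cardE. Qed.

Definition wsum N (s : seq (obs N)) : N.-tuple pauli :=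
  \big[@wadd N/id_word N]_(o <- s) word_of o.

Lemma anticommuting_sym N : symmetric (@anticommuting N).
Proof. by move=> a b; rewrite !anticommutingE spC. Qed.

Lemma anticommuting_irr N : irreflexive (@anticommuting N).
Proof. by move=> a; rewrite anticommutingE spww. Qed.

Lemma sp_wsum_anti N (a : obs N) (s : seq (obs N)) :
  all (anticommuting a) s -> sp (word_of a) (wsum s) = odd (size s).
Proof.
elim: s => [_|b s IH /= /andP[ab /IH E]]; rewrite /wsum ?big_nil ?big_cons.
  by rewrite spC sp0w.
by rewrite spDr -anticommutingE ab -[X in sp _ X]/(wsum s) E.
Qed.

(** Prepending a point multiplies the scalar by a phase whose square is (-1)^(size s) under
    anticommutation; Pascal's rule sums these exponents. *)
Lemma prod_obs_mx N (s : seq (obs N)) :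
  exists k : algC, \big[mulmx/1%:M]_(o <- s) obs_mx o = k *: word_mx (wsum s)
    /\ (pairwise (@anticommuting N) s -> k ^+ 2 = (-1) ^+ 'C(size s, 2)).
Proof.
elim: s => [|a s [k [IH sq]]].
  by exists 1; rewrite /wsum !big_nil word_mx_id scale1r expr0 expr1n.
exists (k * phase (word_of a) (wsum s)).
rewrite /wsum !big_cons IH -scalemxAr word_mxM scalerA; split=> //=.
case/andP=> anti /sq E.
by rewrite exprMn E phase_sqr sp_wsum_anti // signr_odd -exprD binS bin1.
Qed.

Lemma pairwise_in (T : eqType) (r : rel T) (s : seq T) :
  uniq s -> {in s &, forall a b, a != b -> r a b} -> pairwise r s.
Proof.
elim: s => //= a s IH /andP[as_ /IH{}IH] rs.
rewrite IH ?andbT; last by move=> b c bs cs; apply: rs; rewrite inE ?bs ?cs orbT.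
apply/allP=> b bs; apply: rs; rewrite ?inE ?eqxx ?bs ?orbT //.
by apply: contraNneq as_ => ->.
Qed.

Lemma in_pairwise (T : eqType) (r : rel T) (s : seq T) :
  symmetric r -> pairwise r s -> {in s &, forall a b, a != b -> r a b}.
Proof.
move=> rC; elim: s => //= a s IH /andP[/allP ra /IH{}IH] b c.
rewrite !inE => /predU1P[->|bs] /predU1P[->|cs]; rewrite ?eqxx // => bc.
- exact: ra.
- by rewrite rC ra.
- exact: IH.
Qed.

Lemma pairwise_irr_uniq (T : eqType) (r : rel T) (s : seq T) :
  irreflexive r -> pairwise r s -> uniq s.
Proof.
move=> rr; elim: s => //= a s IH /andP[/allP ra /IH ->]; rewrite andbT.
by apply: contraFN (rr a) => /ra.
Qed.

(* The scalar of the product of five anticommuting observables squares to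
   (-1)^C(5,2) = 1, so only the underlying word has to be checked. *)
Lemma is_ovoidE N (Ov : {set obs N}) :
  is_ovoid Ov = [&& size (listing Ov) == 5,
                    pairwise (@anticommuting N) (listing Ov)
                  & wsum (listing Ov) == id_word N].
Proof.
rewrite /is_ovoid size_listing; case: eqP => //= O5.
have -> : [forall a in Ov, forall b in Ov, (a != b) ==> anticommuting a b]
          = pairwise (@anticommuting N) (listing Ov).
  apply/idP/idP=> [/forall_inP anti|anti].
    apply: pairwise_in (listing_uniq _) _ => a b; rewrite !mem_listing.
    by move=> /anti/forall_inP ab /ab/implyP.
  apply/forall_inP=> a aO; apply/forall_inP=> b bO; apply/implyP.
  by apply: (in_pairwise (@anticommuting_sym N) anti); rewrite mem_listing.
case anti: (pairwise _ _) => //=.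
have [k [-> /(_ anti)]] := prod_obs_mx (listing Ov).
rewrite size_listing O5 => /eqP; rewrite -signr_odd expr0 sqrf_eq1 => k1.
apply/idP/eqP=> [|->]; last first.
  rewrite word_mx_id -scaleN1r -{2}[1%:M]scale1r -word_mx_id.
  by rewrite !(inj_eq (@scale_word_mx_inj _ _)).
have kk : k * k = 1 by case/orP: k1 => /eqP ->; rewrite ?mulr1 ?mulrNN ?mulr1.
rewrite -scaleN1r -{1}[1%:M]scale1r -word_mx_id => /orP[]/eqP.
  move/(congr1 ( *:%R k)); rewrite !scalerA kk scale1r.
  exact: word_mx_scale_inj.
move/(congr1 ( *:%R k)); rewrite !scalerA kk scale1r.
exact: word_mx_scale_inj.
Qed.

Lemma ovoid_listing N (Ov : {set obs N}) : is_ovoid Ov ->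
  exists o1 o2 o3 o4 o5 : obs N, let s := [:: o1; o2; o3; o4; o5] in
    [/\ listing Ov = s, pairwise (@anticommuting N) s & wsum s = id_word N].
Proof.
rewrite is_ovoidE; case: (listing Ov) => [|o1 [|o2 [|o3 [|o4 [|o5 [|]]]]]] //=.
by case/andP=> anti /eqP sum0; exists o1, o2, o3, o4, o5.
Qed.

(** Anticommutation is symmetric and [wsum] commutative, so the conditions on the sorted listing can
    be checked in any order. *)
Lemma ovoid_of_seq N (s : seq (obs N)) :
  size s = 5 -> pairwise (@anticommuting N) s -> wsum s = id_word N ->
  is_ovoid [set o in s].
Proof.
move=> s5 anti sum0; have s_uniq := pairwise_irr_uniq (@anticommuting_irr N) anti.
have s_perm : perm_eq (listing [set o in s]) s.
  by apply: uniq_perm => //; [apply: listing_uniq|]=> o; rewrite mem_listing inE.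
rewrite is_ovoidE (perm_size s_perm) s5 /wsum (perm_big _ s_perm) /=.
rewrite -[X in X == _]/(wsum s) sum0 eqxx andbT.
apply: pairwise_in (listing_uniq _) _ => a b; rewrite !(perm_mem s_perm).
exact: in_pairwise (@anticommuting_sym N) anti a b.
Qed.

(** * Embeddings of the two-qubit doily *)

(** Facts about W_2 are checked by running over this list, with [sp2] and [is_sum2] as forms of [sp]
    and [wadd] suited to [vm_compute]. *)
Definition points : seq (obs 2) :=
  [:: IX; IZ; IY; XI; XX; XZ; XY; ZI; ZX; ZZ; ZY; YI; YX; YZ; YY].

Lemma mem_points x : x \in points.
Proof.
case: x => [[[|p [|q [|r s]]] // tup] nid].
by case: p tup nid => tup nid; case: q tup nid => tup nid; vm_compute;
  vm_compute in nid.
Qed.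

Lemma all_pointsP (P : pred (obs 2)) : all P points -> forall x, P x.
Proof. by move/allP=> allP x; apply/allP/mem_points. Qed.

Definition sp2 (x y : obs 2) : bool :=
  pskew (tnth (word_of x) ord0) (tnth (word_of y) ord0)
  (+) pskew (tnth (word_of x) (lift ord0 ord0)) (tnth (word_of y) (lift ord0 ord0)).

Lemma sp2E x y : sp (word_of x) (word_of y) = sp2 x y.
Proof. by rewrite /sp !big_ord_recl big_ord0 addbF. Qed.

Definition is_sum2 (x y z : obs 2) : bool :=
  all (fun i => tnth (word_of z) i == padd (tnth (word_of x) i) (tnth (word_of y) i))
    [:: ord0; lift ord0 ord0].

Lemma is_sum2E x y z :
  (word_of z == wadd (word_of x) (word_of y)) = is_sum2 x y z.
Proof.
apply/eqP/allP=> [zE i _|zE]; first by rewrite zE tnth_mktuple.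
apply: eq_from_tnth => i; rewrite tnth_mktuple; apply/eqP/zE.
by case: i => [[|[|i]] lti]; rewrite // !inE -!val_eqE.
Qed.

(** Nine lines of the form AI, IB, AB, then the six made of words without I. *)
Definition lines : seq (seq (obs 2)) :=
  [:: [:: XI; IX; XX]; [:: XI; IZ; XZ]; [:: XI; IY; XY];
      [:: ZI; IX; ZX]; [:: ZI; IZ; ZZ]; [:: ZI; IY; ZY];
      [:: YI; IX; YX]; [:: YI; IZ; YZ]; [:: YI; IY; YY];
      [:: XX; ZZ; YY]; [:: XX; ZY; YZ]; [:: XZ; ZX; YY];
      [:: XZ; ZY; YX]; [:: XY; ZX; YZ]; [:: XY; ZZ; YX]].

Definition collinear2 (x y : obs 2) : bool :=
  has (fun l => (x \in l) && (y \in l)) lines.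

Section Embedding.

Variables (N : nat) (g : obs 2 -> obs N).

(** Labelings at the level of words. Additivity is asked on commuting pairs only: the coefficients
    [coeffs] below are not additive on [IX], [IZ], [IY]. *)
Definition doily_embedding : Prop :=
  (forall x y, sp (word_of (g x)) (word_of (g y)) = sp2 x y) /\
  (forall x y z, ~~ sp2 x y -> is_sum2 x y z ->
     word_of (g z) = wadd (word_of (g x)) (word_of (g y))).

Hypothesis gE : doily_embedding.

Lemma embedding_absprod x y z :
  ~~ sp2 x y -> is_sum2 x y z -> absprod (g x) (g y) = Some (g z).
Proof.
by case: gE => gsp gadd xy xyz; apply: absprod_Some (gadd _ _ _ xy xyz); rewrite gsp.
Qed.

(** The form on W_2 is nondegenerate: a point is determined by its pairings, which g preserves. *)
Lemma embedding_inj : injective g.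
Proof.
move=> x y gxy; apply/eqP.
have := all_pointsP (_ : all (fun x => all (fun y =>
  all (fun z => sp2 x z == sp2 y z) points ==> (x == y)) points) points) x.
move=> /(_ ltac:(by vm_compute)) /all_pointsP /(_ y) /implyP; apply.
by apply/allP=> z _; case: gE => gsp _; rewrite -!gsp gxy.
Qed.

Lemma embedding_labeling : is_labeling (g @: [set: obs 2]) g.
Proof.
have [gsp gadd] := gE; split=> //; first exact: embedding_inj.
- by move=> a b; rewrite !commutingE gsp sp2E.
- by move=> a b; rewrite !anticommutingE gsp sp2E.
move=> x y xy; rewrite commutingE sp2E => com.
have := all_pointsP (_ : all (fun x => all (fun y =>
  (x != y) && ~~ sp2 x y ==> has (is_sum2 x y) points) points) points) x.
move=> /(_ ltac:(by vm_compute)) /all_pointsP /(_ y); rewrite xy com.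
case/hasP=> z _ xyz; exists z; last exact: embedding_absprod.
by apply: absprod_Some; [rewrite sp2E | apply/eqP; rewrite is_sum2E].
Qed.

Let gline (l : seq (obs 2)) : {set obs N} := [set a in map g l].

Let mem_gline x l : (g x \in gline l) = (x \in l).
Proof. by rewrite inE (mem_map embedding_inj). Qed.

Let glines : {set {set obs N}} := [set l in map gline lines].

Let gline_inj : {in lines &, injective gline}.
Proof.
move=> l m lL mL lm; apply/eqP.
have /allP/(_ _ lL)/allP/(_ _ mL)/implyP : all (fun l : seq (obs 2) =>
  all (fun m : seq (obs 2) => all (fun x => (x \in l) == (x \in m))
    points ==> (l == m)) lines) lines.
  by vm_compute.
by apply; apply/allP=> x _; rewrite -!mem_gline lm.
Qed.

Let mem_glines l : (l \in glines) -> exists2 m, m \in lines & l = gline m.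
Proof. by rewrite inE => /mapP. Qed.

Let collinear_glines x y : collinear glines (g x) (g y) = collinear2 x y.
Proof.
apply/exists_inP/hasP=> [[l /mem_glines[m mL ->]]|[m mL xy]].
  by rewrite !mem_gline; exists m.
by exists (gline m); rewrite ?mem_gline // inE map_f.
Qed.

Let mem_image a : (a \in g @: [set: obs 2]) -> exists x, a = g x.
Proof. by case/imsetP=> x _ ->; exists x. Qed.

(** The lines of W_2 are transported along the injective g, so each axiom becomes a finite check in
    W_2. *)
Lemma embedding_doily : is_doily (g @: [set: obs 2]).
Proof.
have [gsp gadd] := gE; exists glines; split; first split.
- rewrite (card_imset _ embedding_inj) cardsT.
  transitivity #|points|; last by apply/card_uniqP; vm_compute.
  by apply: eq_card => x; rewrite [RHS]mem_points.
- by rewrite cardsE (card_uniqP _) ?map_inj_in_uniq.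
- move=> _ /mem_glines[m mL ->]; split.
    by apply/subsetP=> a; rewrite inE => /mapP[x _ ->]; apply: imset_f.
  rewrite cardsE (card_uniqP _) ?size_map ?(map_inj_uniq embedding_inj).
    by apply/eqP; move: m mL; apply/allP; vm_compute.
  by move: m mL; apply/allP; vm_compute.
- move=> _ /mem_image[x ->].
  have -> : [set l in glines | g x \in l]
            = [set l in map gline [seq l <- lines | x \in l]].
    apply/setP=> l; rewrite in_set [RHS]in_set [l \in glines]in_set.
    apply/andP/mapP=> [[/mapP[m mL ->]]|[m]].
      by rewrite mem_gline => xm; exists m => //; rewrite mem_filter xm.
    rewrite mem_filter => /andP[xm mL] ->; rewrite mem_gline; split=> //.
    exact: map_f.
  rewrite cardsE (card_uniqP _) ?size_map.
    by apply/eqP; move: x; apply: all_pointsP; vm_compute.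
  rewrite map_inj_in_uniq ?filter_uniq // => l m; rewrite !mem_filter.
  by move=> /andP[_ lL] /andP[_ mL]; apply: gline_inj.
- move=> _ _ /mem_image[x ->] /mem_glines[m mL ->]; rewrite mem_gline => xm.
  have := all_pointsP (_ : all (fun x => all (fun m : seq (obs 2) =>
    (x \notin m) ==> (size [seq y <- m | collinear2 x y] == 1%N)) lines) points) x.
  move=> /(_ ltac:(by vm_compute)) /allP /(_ _ mL); rewrite xm /=.
  case E : [seq _ <- _ | _] => [|y [|]] // _.
  have memE z : (z \in m) && collinear2 x z = (z == y).
    by rewrite andbC -(mem_filter (collinear2 x)) E inE.
  exists (g y); split=> [|a []].
    by rewrite mem_gline collinear_glines; apply/andP; rewrite memE.
  rewrite inE => /mapP[z zm ->]; rewrite collinear_glines => xz.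
  by congr g; apply/esym/eqP; rewrite -memE zm.
- move=> _ _ /mem_image[x ->] /mem_image[y ->].
  rewrite (inj_eq embedding_inj) commutingE gsp collinear_glines => xy.
  have := all_pointsP (_ : all (fun x => all (fun y =>
    (x != y) ==> (~~ sp2 x y == collinear2 x y)) points) points) x.
  by move=> /(_ ltac:(by vm_compute)) /all_pointsP /(_ y); rewrite xy => /eqP.
- move=> _ /mem_glines[m mL ->] a b c; rewrite ![_ \in gline _]inE.
  move=> /mapP[x xm ->] /mapP[y ym ->] /mapP[z zm ->] xyz.
  have := allP (_ : all (fun m : seq (obs 2) => all (fun x => all (fun y => all (fun z =>
    uniq [:: x; y; z] ==> ~~ sp2 x y && is_sum2 x y z) m) m) m) lines) m mL.
  move=> /(_ ltac:(by vm_compute)) /allP/(_ _ xm) /allP/(_ _ ym) /allP/(_ _ zm).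
  rewrite -(map_inj_uniq embedding_inj) /= in xyz *; rewrite xyz => /andP[].
  exact: embedding_absprod.
Qed.

End Embedding.

(** * Combinations over F_2 and their Gram form *)

Section Combinations.

Variables (N : nat) (e : nat -> N.-tuple pauli).

Definition comb (B : bitseq) : N.-tuple pauli :=
  \big[@wadd N/id_word N]_(i <- iota 0 5) (if nth false B i then e i else id_word N).

Definition xors (B C : bitseq) : bitseq :=
  mkseq (fun i => nth false B i (+) nth false C i) 5.

Definition gram_form (G : nat -> nat -> bool) (B C : bitseq) : bool :=
  foldr (fun i b => foldr (fun j c =>
      [&& nth false B i, nth false C j & G i j] (+) c) false (iota 0 5) (+) b)
    false (iota 0 5).

Lemma comb_xors B C : comb (xors B C) = wadd (comb B) (comb C).
Proof.
rewrite /comb -big_split big_seq [RHS]big_seq; apply: eq_bigr => i.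
rewrite mem_iota => /= i5; rewrite nth_mkseq //.
by case: (nth _ B i); case: (nth _ C i); rewrite /= ?wadd0w ?waddw0 ?waddww.
Qed.

Lemma sp_comb G B C :
  (forall i j, (i < 5)%N -> (j < 5)%N -> sp (e i) (e j) = G i j) ->
  sp (comb B) (comb C) = gram_form G B C.
Proof.
move=> eG; have spl w : sp (comb B) w
    = \big[addb/false]_(i <- iota 0 5) (nth false B i && sp (e i) w).
  rewrite /comb; elim/big_rec2: _ => [|i b u _ <-]; first by rewrite sp0w.
  by rewrite spDl; case: (nth _ B i); rewrite ?sp0w.
have spr i : sp (e i) (comb C)
    = \big[addb/false]_(j <- iota 0 5) (nth false C j && sp (e i) (e j)).
  rewrite /comb; elim/big_rec2: _ => [|j b u _ <-]; first by rewrite spC sp0w.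
  by rewrite spDr; case: (nth _ C j); rewrite // spC sp0w spC.
have -> : gram_form G B C = \big[addb/false]_(i <- iota 0 5)
    \big[addb/false]_(j <- iota 0 5) [&& nth false B i, nth false C j & G i j].
  by rewrite unlock.
rewrite spl big_seq [RHS]big_seq; apply: eq_bigr => i.
rewrite mem_iota => /andP[_ i5]; rewrite spr.
case: (nth _ B i); last by rewrite [RHS]big1.
rewrite andTb big_seq [RHS]big_seq; apply: eq_bigr => j.
by rewrite mem_iota => /andP[_ j5]; rewrite eG.
Qed.

End Combinations.

(* Coefficients over o1, o2, o3, o4, c of the values of the algorithm, with
   o5 = o1 + o2 + o3 + o4. *)
Definition coeffs (x : obs 2) : bitseq :=
  match val (word_of x) with
  | [:: pI; pX] => [:: true; false; false; false; false]
  | [:: pI; pZ] => [:: false; true; false; false; false]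
  | [:: pI; pY] => [:: false; false; true; false; true]
  | [:: pX; pI] => [:: false; false; false; false; true]
  | [:: pX; pX] => [:: true; false; false; false; true]
  | [:: pX; pZ] => [:: false; true; false; false; true]
  | [:: pX; pY] => [:: false; false; true; false; false]
  | [:: pZ; pI] => [:: false; false; true; true; true]
  | [:: pZ; pX] => [:: true; false; true; true; true]
  | [:: pZ; pZ] => [:: false; true; true; true; true]
  | [:: pZ; pY] => [:: false; false; false; true; false]
  | [:: pY; pI] => [:: true; true; false; true; true]
  | [:: pY; pX] => [:: false; true; false; true; true]
  | [:: pY; pZ] => [:: true; false; false; true; true]
  | [:: pY; pY] => [:: true; true; true; true; false]
  | _ => [::]
  end.

(** The hypotheses fix all pairings between o1, o2, o3, o4, c, so that preservation of the form and
    of the lines becomes a computation on [coeffs]. *)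
Lemma embedding_exists N (o1 o2 o3 o4 o5 c : obs N) :
  pairwise (@anticommuting N) [:: o1; o2; o3; o4; o5] ->
  wsum [:: o1; o2; o3; o4; o5] = id_word N ->
  [&& commuting c o1, commuting c o2, commuting c o3,
      anticommuting c o4 & anticommuting c o5] ->
  exists2 g : obs 2 -> obs N, doily_embedding g
    & [/\ g IX = o1, g IZ = o2, g XY = o3
      & [/\ g ZY = o4, g YY = o5 & g XI = c]].
Proof.
rewrite /= !anticommutingE !commutingE !andbT -!andbA.
move=> /and5P[s12 s13 s14 _ /and5P[s23 s24 _ s34 _]] sum0.
move=> /and5P[/negPf c1 /negPf c2 /negPf c3 c4 _].
pose e i := nth (id_word N) (map (@word_of N) [:: o1; o2; o3; o4; c]) i.
(* Gram matrix of o1, o2, o3, o4, c: the ovoid points pair to 1 with each other, and c (index 4)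
   only with o4 (index 3). *)
pose G i j := (i != j) &&
  (if (i == 4)%N || (j == 4)%N then (i == 3)%N || (j == 3)%N else true).
have eG i j : (i < 5)%N -> (j < 5)%N -> sp (e i) (e j) = G i j.
  by case: i => [|[|[|[|[|i]]]]] //; case: j => [|[|[|[|[|j]]]]] // _ _;
    rewrite /e /G /= ?spww ?(s12, s13, s14, s23, s24, s34, c1, c2, c3, c4) // spC
      ?(s12, s13, s14, s23, s24, s34, c1, c2, c3, c4).
have gsp x y : sp (comb e (coeffs x)) (comb e (coeffs y)) = sp2 x y.
  rewrite (sp_comb _ _ eG); apply/eqP.
  have := all_pointsP (_ : all (fun x => all (fun y =>
    gram_form G (coeffs x) (coeffs y) == sp2 x y) points) points) x.
  by move=> /(_ ltac:(by vm_compute)) /all_pointsP.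
(* Each point of W_2 anticommutes with another one, so its image pairs nontrivially and is not the
   identity. *)
have nid x : comb e (coeffs x) != id_word N.
  have := all_pointsP (_ : all (fun x => has (sp2 x) points) points) x.
  move=> /(_ ltac:(by vm_compute)) /hasP[y _]; rewrite -gsp.
  by apply: contraTneq => ->; rewrite sp0w.
exists (fun x => Obs (nid x)).
  split=> // x y z xy xyz /=; rewrite -comb_xors; congr comb.
  have := all_pointsP (_ : all (fun x => all (fun y => all (fun z =>
    ~~ sp2 x y && is_sum2 x y z
      ==> (coeffs z == xors (coeffs x) (coeffs y))) points) points) points) x.
  move=> /(_ ltac:(by vm_compute)) /all_pointsP /(_ y) /all_pointsP /(_ z).
  by rewrite xy xyz => /eqP.
have o5E : word_of o5 = wadd (word_of o1)
    (wadd (word_of o2) (wadd (word_of o3) (word_of o4))).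
  apply: wadd_eq0; rewrite waddC -sum0 /wsum !big_cons big_nil waddw0.
  by rewrite -!waddA.
by split; [..|split]; apply: val_inj;
  rewrite /= /comb /= !big_cons big_nil /= ?wadd0w ?waddw0 ?o5E.
Qed.

Lemma generateE N (o1 o2 o3 o4 o5 c : obs N) (g : obs 2 -> obs N) :
  doily_embedding g ->
  g IX = o1 -> g IZ = o2 -> g XY = o3 -> g ZY = o4 -> g YY = o5 -> g XI = c ->
  forall x, generate o1 o2 o3 o4 o5 c x = Some (g x).
Proof.
move=> gE <- <- <- <- <- <- x.
(* Invariant of the run: f coincides with g on the points s assigned so far. *)
pose agree (f : partial_map N) (s : seq (obs 2)) :=
  forall x, x \in s -> f x = Some (g x).
have agree_assign f s r : agree f s -> agree (assign f r (Some (g r))) (r :: s).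
  move=> fs y; rewrite inE ffunE; case: eqP => [->|_] //=; exact: fs.
(* A check on the list of triples: each one multiplies two commuting points already assigned, and in
   the end all points are assigned. *)
pose fix closed (s : seq (obs 2)) (ts : seq (obs 2 * obs 2 * obs 2)) : bool :=
  if ts is (p, q, r) :: ts' then
    [&& p \in s, q \in s, ~~ sp2 p q, is_sum2 p q r & closed (r :: s) ts']
  else all (mem s) points.
have run ts : forall f s, agree f s -> closed s ts ->
    forall y, foldl (@step N) f ts y = Some (g y).
  elim: ts => [|[[p q] r] ts IH] f s fs; last rewrite /=.
    rewrite -[closed _ _]/(all (mem s) points) => /allP sP y.
    exact/fs/sP/mem_points.
  case/and5P=> ps qs pq pqr; apply: IH.
  by rewrite fs // fs // (embedding_absprod gE pq pqr); apply: agree_assign.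
apply: (run _ _ [:: XI; YY; ZY; XY; IZ; IX]); last by vm_compute.
by do 6!apply/agree_assign.
Qed.

(** * Doilies *)

Lemma cards3_ex (T : finType) (A : {set T}) : #|A| = 3 ->
  exists x y z, [/\ x \in A, y \in A, z \in A & uniq [:: x; y; z]].
Proof.
rewrite cardE; have := enum_uniq A; have := mem_enum A.
case: (enum A) => [|x [|y [|z [|]]]] // memA xyz _; exists x, y, z.
by split; rewrite -?memA ?inE ?eqxx ?orbT.
Qed.

Section DoilyTheory.

Variables (N : nat) (D : {set obs N}) (L : {set {set obs N}}).
Local Notation w := (@word_of N).

Hypothesis DL : is_GQ22 D L.
Hypothesis commutingD : forall a b, a \in D -> b \in D -> a != b ->
  commuting a b = collinear L a b.
Hypothesis absprodD : forall l, l \in L -> forall a b c,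
  a \in l -> b \in l -> c \in l -> uniq [:: a; b; c] -> absprod a b = Some c.

Lemma neq_sp (a b : obs N) u : sp (w a) u -> ~~ sp (w b) u -> a != b.
Proof. by move=> au; apply: contraNneq => <-. Qed.

Lemma collinear_sp a b :
  a \in D -> b \in D -> a != b -> collinear L a b = ~~ sp (w a) (w b).
Proof. by move=> aD bD ab; rewrite -commutingD // commutingE. Qed.

Lemma line_sub l a : l \in L -> a \in l -> a \in D.
Proof.
move=> lL; have [_ _ /(_ l lL)[/subsetP lD _] _ _] := DL; exact: lD.
Qed.

Lemma line_third l a b : l \in L -> a \in l -> b \in l -> a != b ->
  exists c, [/\ c \in l, ~~ sp (w a) (w b), w c = wadd (w a) (w b)
              & l = [set a; b; c]].
Proof.
move=> lL al bl ab; have [_ _ /(_ l lL)[_ l3] _ _] := DL.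
have [c cl cab] : exists2 c, c \in l & c \notin [set a; b].
  apply/subsetPn; apply: contraTN isT => /subset_leq_card.
  by rewrite l3 cards2 ab.
have := cab; rewrite !inE negb_or ![c == _]eq_sym => /andP[ac bc].
have abc : uniq [:: a; b; c] by rewrite /= !inE negb_or ab ac bc.
have /eqP/absprodP[sab cE] := absprodD lL al bl cl abc.
exists c; split=> //; apply/esym/eqP; rewrite setUC eqEcard l3 cardsU1 cards2.
rewrite cab ab andbT; apply/subsetP=> x; rewrite !inE.
by case/or3P=> /eqP ->.
Qed.

(** The third point of a line is the sum of the two others. *)
Lemma line_eq l m a b : l \in L -> m \in L -> a != b ->
  a \in l -> b \in l -> a \in m -> b \in m -> l = m.
Proof.
move=> lL mL ab al bl am bm.
have [c [_ _ cE ->]] := line_third lL al bl ab.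
have [d [_ _ dE ->]] := line_third mL am bm ab.
by suff -> : c = d by []; apply: val_inj; rewrite /= cE dE.
Qed.

Lemma doily_add a b : a \in D -> b \in D -> a != b -> ~~ sp (w a) (w b) ->
  exists2 c, c \in D & w c = wadd (w a) (w b).
Proof.
move=> aD bD ab; rewrite -collinear_sp // => /exists_inP[l lL /andP[al bl]].
by have [c [cl _ cE _]] := line_third lL al bl ab; exists c; rewrite ?(line_sub lL).
Qed.

Lemma doily_lines p : p \in D -> exists l1 l2 l3,
  [/\ (l1 \in L) && (p \in l1), (l2 \in L) && (p \in l2),
      (l3 \in L) && (p \in l3) & uniq [:: l1; l2; l3]].
Proof.
move=> pD; have [_ _ _ /(_ p pD)/cards3_ex[l1 [l2 [l3 [L1 L2 L3 uL]]]] _] := DL.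
by rewrite !in_set in L1 L2 L3; exists l1, l2, l3.
Qed.

(** A point p lies on 3 of the 15 lines, hence misses some line l; only one point of l is collinear
    with p. *)
Lemma doily_noncollinear : exists p q, [/\ p \in D, q \in D & sp (w p) (w q)].
Proof.
have [D15 L15 Lline Dlines GQ] := DL.
have /card_gt0P[p pD] : (0 < #|D|)%N by rewrite D15.
have [l lL pl] : exists2 l, l \in L & p \notin l.
  apply/exists_inP; apply: contraT; rewrite negb_exists_in.
  move/forall_inP=> Lp; have := Dlines p pD.
  suff -> : [set l in L | p \in l] = L by rewrite L15.
  by apply/setP=> l; rewrite inE; apply/andb_idr => /Lp; rewrite negbK.
have [r [_ r_uniq]] := GQ p l pD lL pl.
have [_ /cards3_ex[x [y [z [xl yl _ /andP[xyz _]]]]]] := Lline l lL.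
have xy : x != y by apply: contraNneq xyz => ->; rewrite inE eqxx.
have [q ql qr] : exists2 q, q \in l & q != r.
  by have [xr|xr] := eqVneq x r; [exists y; rewrite // -xr eq_sym | exists x].
have qD := line_sub lL ql; exists p, q; split=> //; apply: contraNT qr => pq.
rewrite eq_sym; apply/eqP/r_uniq; split=> //; rewrite collinear_sp //.
by apply: contraNneq pl => ->.
Qed.

(** On each of the three lines through p, the point q has one neighbour. Two of these neighbours
    cannot commute, since the quadrangle has no triangles. *)
Lemma common_neighbours p q : p \in D -> q \in D -> sp (w p) (w q) ->
  exists x y z, [/\ [&& x \in D, y \in D & z \in D],
    [&& ~~ sp (w p) (w x), ~~ sp (w p) (w y) & ~~ sp (w p) (w z)],
    [&& ~~ sp (w q) (w x), ~~ sp (w q) (w y) & ~~ sp (w q) (w z)]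
  & [&& sp (w x) (w y), sp (w x) (w z) & sp (w y) (w z)]].
Proof.
move=> pD qD pq; have [_ _ _ _ GQ] := DL.
have nbr l : (l \in L) && (p \in l) ->
    exists x, [/\ x \in l, x != p, x \in D, ~~ sp (w p) (w x) & ~~ sp (w q) (w x)].
  case/andP=> lL pl.
  have qp : q != p by apply: contraTneq pq => ->; rewrite spww.
  have ql : q \notin l.
    apply: contraTN pq => ql.
    by rewrite eq_sym in qp; have [c []] := line_third lL pl ql qp.
  have [x [[xl qx] _]] := GQ q l qD lL ql; have xD := line_sub lL xl.
  have qx' : q != x by apply: contraNneq ql => ->.
  move: qx; rewrite collinear_sp // => qx.
  have px : p != x by apply: contraTneq pq => ->; rewrite spC.
  exists x; rewrite eq_sym; split=> //.
  by have [c []] := line_third lL pl xl px.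
have anti l m x y : (l \in L) && (p \in l) -> (m \in L) && (p \in m) -> l != m ->
    x \in l -> x != p -> y \in m -> y != p -> sp (w x) (w y).
  move=> /andP[lL pl] /andP[mL pm] lm xl xp ym yp; apply: contraTT lm => xy.
  rewrite negbK; apply/eqP; have [yl|yl] := boolP (y \in l).
    by apply: (line_eq lL mL (a := p) (b := y)); rewrite // eq_sym.
  have yD := line_sub mL ym; have xD := line_sub lL xl.
  have [r [_ r_uniq]] := GQ y l yD lL yl.
  (* Otherwise x and p, both on l, would each be the unique neighbour r of y. *)
  case/eqP: xp; transitivity r; [apply/esym|]; apply: r_uniq; split=> //.
    by rewrite collinear_sp 1?spC //; apply: contraNneq yl => ->.
  by apply/exists_inP; exists m; rewrite ?ym.
have [l1 [l2 [l3 [Ll1 Ll2 Ll3]]]] := doily_lines pD.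
rewrite /= !inE negb_or andbT => /andP[/andP[l12 l13] l23].
have [x [xl xp xD px qx]] := nbr l1 Ll1.
have [y [yl yp yD py qy]] := nbr l2 Ll2.
have [z [zl zp zD pz qz]] := nbr l3 Ll3.
exists x, y, z; rewrite xD yD zD px py pz qx qy qz; split=> //.
rewrite (anti l1 l2 x y Ll1 Ll2) ?(anti l1 l3 x z Ll1 Ll3) //.
exact: (anti l2 l3 y z Ll2 Ll3).
Qed.

(* For p, q noncollinear with common neighbours x, y, z, the ovoid is
   {x, y, p + z, q + z, p + q + x + y}. *)
Lemma doily_ovoid : exists2 Ov : {set obs N}, is_ovoid Ov & Ov \subset D.
Proof.
have [p [q [pD qD pq]]] := doily_noncollinear.
have [x [y [z [/and3P[xD yD zD]]]]] := common_neighbours pD qD pq.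
move=> /and3P[px py pz] /and3P[qx qy qz] /and3P[xy xz yz].
have neg (u v : N.-tuple pauli) : ~~ sp u v -> (sp u v = false) * (sp v u = false).
  by rewrite [sp v u]spC => /negPf ->.
have pos (u v : N.-tuple pauli) : sp u v -> (sp u v = true) * (sp v u = true).
  by rewrite [sp v u]spC => ->.
have spE := (neg _ _ px, neg _ _ py, neg _ _ pz, neg _ _ qx, neg _ _ qy, neg _ _ qz,
  pos _ _ pq, pos _ _ xy, pos _ _ xz, pos _ _ yz, spww, spDl, spDr).
have [a aD aE] : exists2 a, a \in D & w a = wadd (w p) (w z).
  by apply: doily_add; rewrite ?(@neq_sp p z (w q)) ?spE.
have [b bD bE] : exists2 b, b \in D & w b = wadd (w q) (w z).
  by apply: doily_add; rewrite ?(@neq_sp q z (w p)) ?spE.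
(* As p and q anticommute, p + q + x + y is reached through p + x and q + y, which commute. *)
have [g gD gE] : exists2 g, g \in D & w g = wadd (w p) (w x).
  by apply: doily_add; rewrite ?(@neq_sp p x (w q)) ?spE.
have [h hD hE] : exists2 h, h \in D & w h = wadd (w q) (w y).
  by apply: doily_add; rewrite ?(@neq_sp q y (w p)) ?spE.
have [t tD tE] : exists2 t, t \in D & w t = wadd (w g) (w h).
  by apply: doily_add; rewrite ?(@neq_sp g h (w q)) ?gE ?hE ?spE.
exists [set o in [:: x; y; a; b; t]]; last first.
  apply/subsetP=> o; rewrite !inE.
  by case/or4P=> [||| /orP[]] /eqP ->.
apply: ovoid_of_seq => //.
  by rewrite /= !anticommutingE !(aE, bE, tE, gE, hE) !spE.
rewrite /wsum !big_cons big_nil waddw0 tE gE hE aE bE.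
apply: eq_from_tnth => i; rewrite !tnth_mktuple tnth_id.
by case: (tnth (w p) i); case: (tnth (w q) i); case: (tnth (w x) i);
  case: (tnth (w y) i); case: (tnth (w z) i).
Qed.

(** * Position of a point with respect to an ovoid *)

Section InOvoid.

Variables o1 o2 o3 o4 o5 : obs N.
Let s := [:: o1; o2; o3; o4; o5].
Hypothesis s_anti : pairwise (@anticommuting N) s.
Hypothesis s_sum : wsum s = id_word N.
Hypothesis sD : {subset s <= D}.

Definition pattern (c : obs N) : bitseq := [seq sp (w c) (w o) | o <- s].

Let s_sp : {in s &, forall a b, a != b -> sp (w a) (w b)}.
Proof.
move=> a b aS bS ab; rewrite -anticommutingE.
exact: (in_pairwise (@anticommuting_sym N) s_anti).
Qed.

Let s_uniq : uniq s.
Proof. exact: pairwise_irr_uniq (@anticommuting_irr N) s_anti. Qed.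

(** The ovoid sums to 0, hence so do its pairings with c. *)
Let pattern_even c : ~~ odd (count id (pattern c)).
Proof.
have /(congr1 (sp (w c))) := s_sum.
rewrite [RHS]spC sp0w /wsum !big_cons big_nil waddw0 !spDr /=.
by case: (sp _ _); case: (sp _ _); case: (sp _ _); case: (sp _ _); case: (sp _ _).
Qed.

(* Otherwise the three lines through c would cover the five points of the
   ovoid, of which each line contains at most one. *)
Lemma commuting_with_ovoid c : c \in D -> c \notin s -> has id (pattern c).
Proof.
move=> cD cs; apply: contraT; rewrite has_map => /hasPn /= cS.
have lineP o : exists l, (o \in s) ==> [&& l \in L, c \in l & o \in l].
  have [oS|] := boolP (o \in s); last by exists set0.
  have : collinear L c o.
    have oD := sD oS; rewrite collinear_sp ?cS //.
    by apply: contraNneq cs => ->.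
  by case/exists_inP=> l lL /andP[cl ol]; exists l; rewrite lL cl ol.
pose f o := xchoose (lineP o).
have fP o : o \in s -> [&& f o \in L, c \in f o & o \in f o].
  by move=> oS; have /implyP := xchooseP (lineP o); apply.
have f_inj : {in s &, injective f}.
  move=> a b aS bS fab; apply: contraTeq isT => ab.
  have /and3P[lL _ al] := fP a aS; have /and3P[_ _] := fP b bS; rewrite -fab => bl.
  by have [d []] := line_third lL al bl ab; rewrite s_sp.
have [_ _ _ /(_ c cD) c3 _] := DL.
have : (size (map f s) <= #|[set l in L | c \in l]|)%N.
  rewrite cardE; apply: uniq_leq_size; first by rewrite map_inj_in_uniq.
  by move=> _ /mapP[o oS ->]; rewrite mem_enum inE; case/and3P: (fP o oS) => -> ->.
by rewrite c3.
Qed.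

(** Effect on the pattern of adding the i-th ovoid point, which pairs to 1 with the four others and
    to 0 with itself. *)
Definition flip i (P : bitseq) : bitseq :=
  mkseq (fun j => nth false P j (+) (j != i)) 5.

Lemma pattern_flip c i : c \in D -> (i < 5)%N -> c != nth c s i ->
  ~~ nth false (pattern c) i ->
  exists2 d, d \in D & pattern d = flip i (pattern c).
Proof.
move=> cD i5 ci; rewrite (nth_map c) // => sci.
have iS : nth c s i \in s by rewrite mem_nth.
have [d dD dE] := doily_add cD (sD iS) ci sci.
exists d => //; apply: (@eq_from_nth _ false) => [|j]; rewrite size_map // => j5.
rewrite nth_mkseq // !(nth_map c) // dE spDl; congr (_ (+) _).
have [->|ij] := eqVneq j i; first by rewrite spww.
by rewrite s_sp ?mem_nth ?nth_uniq // eq_sym.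
Qed.

(** Used to see that a point whose pattern has two true entries lies outside the ovoid. *)
Lemma pattern_self i c : (i < 5)%N -> c = nth c s i -> count id (pattern c) = 4.
Proof.
move=> i5 ->; have iS : nth c s i \in s by apply: mem_nth.
rewrite count_map (permP (perm_to_rem iS)) /= spww add0n.
rewrite -[4]/(size s).-1 -(size_rem iS); apply/eqP; rewrite -all_count.
apply/allP=> o; rewrite (mem_rem_uniq _ s_uniq) inE => /andP[oi oS] /=.
by apply: s_sp; rewrite // eq_sym.
Qed.

Let pattern_step c i : c \in D -> (i < 5)%N -> count id (pattern c) = 2 ->
  ~~ nth false (pattern c) i ->
  exists2 d, d \in D & pattern d = flip i (pattern c).
Proof.
move=> cD i5 c2; apply: pattern_flip => //.
by apply/eqP=> /(pattern_self i5); rewrite c2.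
Qed.

(** Take the other points r and r' = r + o1 of a line through o1. Both commute with o1 and are
    complementary on o2, ..., o5, so their counts add up to 4; both counts are even and nonzero,
    hence 2. *)
Lemma doily_pattern2 : exists2 c, c \in D & count id (pattern c) = 2.
Proof.
have o1S : o1 \in s by rewrite inE eqxx.
have [l [_ [_ [/andP[lL o1l] _ _ _]]]] := doily_lines (sD o1S).
have [_ _ /(_ l lL)[_ l3] _ _] := DL.
have [r rl ro1] : exists2 r, r \in l & r != o1.
  have /card_gt0P[r] : (0 < #|l :\ o1|)%N.
    by move: l3; rewrite (cardsD1 o1) o1l add1n => -[->].
  by rewrite !inE => /andP[]; exists r.
have [r' [r'l ro1s r'E lE]] := line_third lL rl o1l ro1.
have rD := line_sub lL rl; have r'D := line_sub lL r'l.
have nS c : c != o1 -> ~~ sp (w c) (w o1) -> c \notin s.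
  by move=> co1; apply: contraNN => cS; apply: s_sp.
have r'o1 : r' != o1.
  (* If r' = o1, then r = r' + o1 would be the identity. *)
  apply/eqP=> r'o1; move: r'E (valP r); rewrite r'o1 waddC => /(congr1 (wadd (w o1))).
  by rewrite waddww waddKw /= => <-; rewrite eqxx.
have r'o1s : ~~ sp (w r') (w o1) by rewrite r'E spDl spww (negPf ro1s).
have [r2|r2] := eqVneq (count id (pattern r)) 2; first by exists r.
exists r' => //; have := pattern_even r; have := pattern_even r'.
have := commuting_with_ovoid rD (nS _ ro1 ro1s).
have := commuting_with_ovoid r'D (nS _ r'o1 r'o1s).
move: r2; rewrite /= r'E !spDl spww (negPf ro1s).
have [-> -> -> ->] : [/\ sp (w o1) (w o2) = true, sp (w o1) (w o3) = true,
    sp (w o1) (w o4) = true & sp (w o1) (w o5) = true].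
  have := s_anti; rewrite /= !anticommutingE.
  by case/andP=> /and5P[-> -> -> ->].
by case: (sp (w r) _); case: (sp (w r) _); case: (sp (w r) _); case: (sp (w r) _).
Qed.

(* The moves c -> c + o_i act on the pairs of points of the ovoid not
   collinear with c as the edges of the Petersen graph, which is connected. *)
Lemma doily_pattern :
  exists2 c, c \in D & pattern c = [:: false; false; false; true; true].
Proof.
pose target := [:: false; false; false; true; true].
have one P i : flip i P = target -> count id P = 2 -> (i < 5)%N -> ~~ nth false P i ->
    forall c, c \in D -> pattern c = P -> exists2 d, d \in D & pattern d = target.
  move=> <- P2 i5 Pi c cD cP; rewrite -cP; apply: pattern_step; rewrite ?cP //.
have two P i j : flip j (flip i P) = target -> count id P = 2 ->
    count id (flip i P) = 2 -> (i < 5)%N -> (j < 5)%N ->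
    ~~ nth false P i -> ~~ nth false (flip i P) j ->
    forall c, c \in D -> pattern c = P -> exists2 d, d \in D & pattern d = target.
  move=> ij P2 iP2 i5 j5 Pi Pj c cD cP.
  have [||d dD dP] := @pattern_step c i cD i5; rewrite ?cP //.
  by apply: (one _ j ij iP2 j5 Pj d dD); rewrite dP cP.
have [c cD c2] := doily_pattern2; move: c2.
case cP: (pattern c) => [|b1 [|b2 [|b3 [|b4 [|b5 [|]]]]]] //.
move: cP; case: b1; case: b2; case: b3; case: b4; case: b5 => // cP _.
(* Besides the target itself: a pair among o1, o2, o3 needs one move, by the third of these points;
   a pair {o_a, o4} or {o_a, o5} needs two, by o5 or o4 respectively and then by o_a. *)
all: first
  [ by exists c
  | by apply: (one _ 0 _ _ _ _ c cD cP) | by apply: (one _ 1%N _ _ _ _ c cD cP)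
  | by apply: (one _ 2 _ _ _ _ c cD cP)
  | by apply: (two _ 4 0 _ _ _ _ _ _ _ c cD cP)
  | by apply: (two _ 4 1%N _ _ _ _ _ _ _ c cD cP)
  | by apply: (two _ 4 2 _ _ _ _ _ _ _ c cD cP)
  | by apply: (two _ 3 0 _ _ _ _ _ _ _ c cD cP)
  | by apply: (two _ 3 1%N _ _ _ _ _ _ _ c cD cP)
  | by apply: (two _ 3 2 _ _ _ _ _ _ _ c cD cP) ].
Qed.

End InOvoid.

(** Following [triples], each new value is the sum of two distinct commuting points already in D, so
    the image lies in D; both have 15 points. *)
Lemma embedding_onto (g : obs 2 -> obs N) : doily_embedding g ->
  {subset map g [:: IX; IZ; XY; ZY; YY; XI] <= D} -> g @: [set: obs 2] = D.
Proof.
move=> gE gD; have gDP x : x \in [:: IX; IZ; XY; ZY; YY; XI] -> g x \in D.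
  by move=> xs; apply/gD/map_f.
have gadd p q r : g p \in D -> g q \in D -> [&& p != q, ~~ sp2 p q & is_sum2 p q r] ->
    g r \in D.
  move=> pD qD /and3P[pq spq pqr]; have [gsp ga] := gE.
  have [||c cD cE] := doily_add pD qD; rewrite ?(inj_eq (embedding_inj gE)) ?gsp //.
  by suff -> : g r = c by []; apply: val_inj; rewrite /= (ga p q r) // cE.
have gIX := gDP IX isT; have gIZ := gDP IZ isT; have gXY := gDP XY isT.
have gZY := gDP ZY isT; have gYY := gDP YY isT; have gXI := gDP XI isT.
have gXX := gadd XI IX XX gXI gIX isT.
have gXZ := gadd XI IZ XZ gXI gIZ isT.
have gIY := gadd XI XY IY gXI gXY isT.
have gYZ := gadd ZY XX YZ gZY gXX isT.
have gYX := gadd ZY XZ YX gZY gXZ isT.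
have gZI := gadd ZY IY ZI gZY gIY isT.
have gZZ := gadd YY XX ZZ gYY gXX isT.
have gZX := gadd YY XZ ZX gYY gXZ isT.
have gYI := gadd YY IY YI gYY gIY isT.
have gall : forall x, g x \in D.
  apply: all_pointsP; rewrite /= gIX gIZ gXY gZY gYY gXI gXX gXZ gIY.
  by rewrite gYZ gYX gZI gZZ gZX gYI.
have [M [[g15 _ _ _ _] _ _]] := embedding_doily gE; have [D15 _ _ _ _] := DL.
apply/eqP; rewrite eqEcard g15 D15 andbT.
by apply/subsetP=> _ /imsetP[x _ ->].
Qed.

End DoilyTheory.

(** This gives the uniqueness of c: the commutation conditions single out [XI] in W_2. *)
Lemma embedding_pattern N (g : obs 2 -> obs N) x :
  doily_embedding g ->
  ~~ sp (word_of (g x)) (word_of (g IX)) -> ~~ sp (word_of (g x)) (word_of (g IZ)) ->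
  ~~ sp (word_of (g x)) (word_of (g XY)) -> sp (word_of (g x)) (word_of (g ZY)) ->
  x = XI.
Proof.
case=> gsp _; rewrite !gsp => h1 h2 h3 h4.
have := all_pointsP (_ : all (fun x =>
  [&& ~~ sp2 x IX, ~~ sp2 x IZ, ~~ sp2 x XY & sp2 x ZY] ==> (x == XI)) points) x.
by move=> /(_ ltac:(by vm_compute)); rewrite h1 h2 h3 h4 => /eqP.
Qed.

(** * Correctness and completeness *)

Lemma pimage_total N (f : partial_map N) g :
  (forall x, f x = Some (g x)) -> pimage f = g @: [set: obs 2].
Proof.
move=> fg; apply/setP=> a; rewrite inE; apply/existsP/imsetP=> [[x]|[x _ ->]].
  by rewrite fg => /eqP[<-]; exists x.
by exists x; rewrite fg.
Qed.

Lemma listing_word_inj N :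
  injective (fun A : {set obs N} => map (@word_of N) (listing A)).
Proof.
move=> A B /(inj_map val_inj) AB.
by apply/setP=> a; rewrite -!mem_listing AB.
Qed.

Lemma set_le_anti N : antisymmetric (@set_le N).
Proof. by move=> A B /le_anti/listing_word_inj. Qed.

Lemma smallest_ovoid_exists N (D : {set obs N}) : is_doily D ->
  exists Ov, smallest_ovoid Ov D.
Proof.
case=> L [DL com ab]; have [O1 O1ov O1D] := doily_ovoid DL com ab.
pose P (A : {set obs N}) := is_ovoid A && (A \subset D).
(* The type [seqlexi] selects the lexicographic order, so that comparing keys is [set_le]. *)
pose key (A : {set obs N}) : seqlexi (N.-tuplelexi pauli) := map (@word_of N) (listing A).
have [|Ov /andP[ov oD] ov_min] := @arg_minP _ _ _ O1 P key; first by rewrite /P O1ov.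
exists Ov; rewrite /smallest_ovoid ov oD /=; apply/forallP=> A; apply/implyP.
exact: ov_min.
Qed.

Lemma smallest_ovoid_unique N (D A B : {set obs N}) :
  smallest_ovoid A D -> smallest_ovoid B D -> A = B.
Proof.
move=> /and3P[ovA AD /forallP Amin] /and3P[ovB BD /forallP Bmin].
apply: set_le_anti; apply/andP; split.
  by apply: (implyP (Amin B)); rewrite ovB.
by apply: (implyP (Bmin A)); rewrite ovA.
Qed.

(** The point c of [doily_pattern] yields a labeling g onto D. Any other choice d with image D lies
    in D, so is some g x, and its commutation with the ovoid forces x = [XI]. *)
Lemma count_retained N (D Ov : {set obs N}) : is_doily D -> smallest_ovoid Ov D ->
  count (fun f => pimage f == D) (retained_from Ov) = 1.
Proof.
move=> Ddoily ovD; have /and3P[ov oD _] := ovD.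
have [o1 [o2 [o3 [o4 [o5 [Os anti sum0]]]]]] := ovoid_listing ov.
have [L [DL com ab]] := Ddoily.
have sD : {subset [:: o1; o2; o3; o4; o5] <= D}.
  by move=> o; rewrite -Os mem_listing; apply: (subsetP oD).
have [c cD [c1 c2 c3 c4 c5]] := doily_pattern DL com ab anti sum0 sD.
pose cond (c : obs N) := [&& commuting c o1, commuting c o2, commuting c o3,
  anticommuting c o4 & anticommuting c o5].
have cc : cond c by rewrite /cond !commutingE !anticommutingE c1 c2 c3 c4 c5.
have [g gE [g1 g2 g3 [g4 g5 gc]]] := embedding_exists anti sum0 cc.
have gD : g @: [set: obs 2] = D.
  apply: (embedding_onto DL com ab gE) => a; rewrite /= g1 g2 g3 g4 g5 gc.
  have := sD a; rewrite !inE => sDa.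
  by case/or4P=> [e|e|e|/or3P[e|e|/eqP->]] //; apply: sDa; rewrite e ?orbT.
rewrite /retained_from Os count_filter count_map.
(* Among the admissible choices, exactly c passes both the image test and the retention test. *)
rewrite (@eq_in_count _ _ (pred1 c)); last first.
  move=> d; rewrite mem_filter => /andP[dc _].
  have [h hE [h1 h2 h3 [h4 h5 hd]]] := embedding_exists anti sum0 dc.
  have genE := generateE hE h1 h2 h3 h4 h5 hd.
  rewrite /= (pimage_total genE); apply/andP/eqP=> [[/eqP hD _]|dE].
    have : d \in D by rewrite -hD -hd imset_f.
    rewrite -gD => /imsetP[x _ dE]; rewrite dE -gc; congr g.
    move: dc; rewrite !commutingE !anticommutingE dE => /and5P[? ? ? ? _].
    by apply: (embedding_pattern gE); rewrite ?g1 ?g2 ?g3 ?g4.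
  have hD : h @: [set: obs 2] = D.
    rewrite -gD; apply: eq_imset => x; apply: Some_inj.
    by rewrite -genE dE (generateE gE).
  by rewrite hD.
rewrite count_uniq_mem; first by rewrite mem_filter mem_enum -/(cond c) cc.
exact/filter_uniq/enum_uniq.
Qed.

Close Scope ring_scope.

Theorem mainTheorem6 (N : nat) (hN : 2 <= N) :
  (forall f : partial_map N, f \in doily_generation N ->
     exists (g : obs 2 -> obs N) (D : {set obs N}),
       [/\ forall x, f x = Some (g x), is_doily D & is_labeling D g])
  /\
  (forall D : {set obs N}, is_doily D ->
     count (fun f => pimage f == D) (doily_generation N) = 1).
Proof.
split=> [f /flatten_mapP[Ov]|D Ddoily].
  rewrite mem_enum inE => ov.
  have [o1 [o2 [o3 [o4 [o5 [Os anti sum0]]]]]] := ovoid_listing ov.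
  rewrite /retained_from Os mem_filter => /andP[_ /mapP[c]].
  rewrite mem_filter => /andP[cc _ ->].
  have [g gE [g1 g2 g3 [g4 g5 gc]]] := embedding_exists anti sum0 cc.
  exists g, (g @: [set: obs 2]); split; first exact: generateE.
    exact: embedding_doily.
  exact: embedding_labeling.
have [Ov OvD] := smallest_ovoid_exists Ddoily.
rewrite count_flatten -map_comp.
(* A map with image D retained from A makes A the smallest ovoid of D, so only the run on [Ov]
   contributes, and it contributes 1. *)
have -> : sumn [seq count (fun f => pimage f == D) (retained_from A)
              | A <- enum [set A : {set obs N} | is_ovoid A]]
          = count_mem Ov (enum [set A : {set obs N} | is_ovoid A]).
  rewrite -sumn_count; congr sumn; apply/eq_in_map => A _ /=.
  have [->|AOv] := eqVneq A Ov; first by rewrite count_retained.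
  apply/eqP; rewrite -leqn0 leqNgt -has_count; apply/hasPn=> f.
  case E: (listing A) => [|o1 [|o2 [|o3 [|o4 [|o5 [|]]]]]]; rewrite /retained_from E //.
  rewrite mem_filter => /andP[Af _]; apply: contra AOv => /eqP fD.
  by apply/eqP/(@smallest_ovoid_unique _ D); rewrite // -fD.
rewrite count_uniq_mem ?enum_uniq // mem_enum inE.
by have /and3P[-> _ _] := OvD.
Qed.
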